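(* Let $X$ be a uniformly convex real Banach space, let $K$ be a nonempty closed convex subset of $X$, and let $m\ge 1$ be an integer. For each $i=1,\dots,m$ let $I_i:K\to K$ be a continuous total asymptotically nonexpansive mapping with sequences $\{\tilde\mu_{in}\}_{n\ge1},\{\tilde\lambda_{in}\}_{n\ge1}$ and function $\varphi_i$, and let $T_i:K\to K$ be a continuous total asymptotically $I_i$-nonexpansive mapping with sequences $\{\mu_{in}\}_{n\ge1},\{\lambda_{in}\}_{n\ge1}$ and function $\phi_i$. Assume that $F:=\bigcap_{i=1}^m\left(F(T_i)\cap F(I_i)\right)\neq\emptyset$. Suppose that for all $i=1,\dots,m$ $$\sum_{n=1}^\infty\mu_{in}<\infty,\quad \sum_{n=1}^\infty\lambda_{in}<\infty,\quad \sum_{n=1}^\infty\tilde\mu_{in}<\infty,\quad \sum_{n=1}^\infty\tilde\lambda_{in}<\infty,$$ and that there exist $M_i,M_i^*,N_i,N_i^*>0$ ($i=1,\dots,m$) such that $\phi_i(\xi)\le M_i^*\xi$ for all $\xi\ge M_i$ and $\varphi_i(\zeta)\le N_i^*\zeta$ for all $\zeta\ge N_i$. Let $\{\alpha_{jn}\}_{n\ge1}$ and $\{\beta_{jn}\}_{n\ge1}$, $j=0,1,\dots,m$, be sequences in $(0,1)$ with $\sum_{j=0}^m\alpha_{jn}=1$ and $\sum_{j=0}^m\beta_{jn}=1$ for all $n$. Let $x_1\in K$ be arbitrary and define, for $n\ge1$, $$y_n=\beta_{0n}x_n+\sum_{i=1}^m\beta_{in}I_i^nx_n,\qquad x_{n+1}=\alpha_{0n}x_n+\sum_{i=1}^m\alpha_{in}T_i^ny_n.$$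 Then $\{x_n\}$ converges strongly (in norm) to a common fixed point in $F$ if and only if $$\liminf_{n\to\infty}d(x_n,F)=0.$$
   Context: $F(T)=\{x\in K: Tx=x\}$ denotes the fixed point set of $T:K\to K$, $T^n$ the $n$-th iterate, and $d(x,F)=\inf_{p\in F}\|x-p\|$. $\mathbb{R}^+=[0,\infty)$. A mapping $I:K\to K$ is total asymptotically nonexpansive with sequences $\{\tilde\mu_n\},\{\tilde\lambda_n\}$ and function $\varphi$ if $\tilde\mu_n,\tilde\lambda_n\ge0$, $\tilde\mu_n,\tilde\lambda_n\to0$ as $n\to\infty$, $\varphi:\mathbb{R}^+\to\mathbb{R}^+$ is strictly increasing and continuous with $\varphi(0)=0$, and $\|I^nx-I^ny\|\le\|x-y\|+\tilde\mu_n\varphi(\|x-y\|)+\tilde\lambda_n$ for all $x,y\in K$, $n\ge1$. Given $I:K\to K$, a mapping $T:K\to K$ is total asymptotically $I$-nonexpansive with sequences $\{\mu_n\},\{\lambda_n\}$ and function $\phi$ if $\mu_n,\lambda_n\ge0$, $\mu_n,\lambda_n\to0$, $\phi:\mathbb{R}^+\to\mathbb{R}^+$ is strictly increasing and continuous with $\phi(0)=0$, and $\|T^nx-T^ny\|\le\|I^nx-I^ny\|+\mu_n\phi(\|I^nx-I^ny\|)+\lambda_n$ for all $x,y\in K$, $n\ge1$. *)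

(* Defs.v *)
From HB Require Import structures.
From mathcomp Require Import all_boot all_order all_algebra.
From mathcomp Require Import all_classical all_reals all_analysis.

Set Implicit Arguments.
Unset Strict Implicit.
Unset Printing Implicit Defensive.

Import Order.TTheory GRing.Theory Num.Theory.
Import numFieldNormedType.Exports.

Local Open Scope classical_set_scope.
Local Open Scope ring_scope.

(* Clarkson's definition, with the unit ball in place of the unit sphere
   (a common and equivalent convention). *)
Definition uniformly_convex (R : realType) (X : normedModType R) : Prop :=
  forall eps : R, 0 < eps -> eps <= 2 ->
  exists2 delta : R, 0 < delta &
    forall x y : X, `|x| <= 1 -> `|y| <= 1 -> eps <= `|x - y| ->
      `|2^-1 *: (x + y)| <= 1 - delta.

(* A strictly increasing continuous function from [0, +oo[ to itself that
   vanishes at 0. The values outside [0, +oo[ are unconstrained. *)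
Definition gauge_function (R : realType) (f : R -> R) : Prop :=
  [/\ set_fun `[0, +oo[ `[0, +oo[ f,
      {in `[0, +oo[ &, {homo f : s t / s < t}},
      {within `[0, +oo[, continuous f} &
      f 0 = 0].

(* Sequences are indexed from 1: the value at index 0 is unconstrained. *)
Definition nonneg_null_sequence (R : realType) (u : nat -> R) : Prop :=
  (forall n, (1 <= n)%N -> 0 <= u n) /\ u @ \oo --> (0 : R).

Section mappings.
Context (R : realType) (X : normedModType R) (K : set X).

(* {fun K >-> K} is the type of functions X -> X that map K into K; their
   values outside K play no role below. *)
Definition total_asymptotically_nonexpansive (I : {fun K >-> K})
    (mu lam : nat -> R) (f : R -> R) : Prop :=
  [/\ nonneg_null_sequence mu, nonneg_null_sequence lam, gauge_function f &
      forall x y n, K x -> K y -> (1 <= n)%N ->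
        `|iter n I x - iter n I y| <=
          `|x - y| + mu n * f `|x - y| + lam n].

Definition total_asymptotically_I_nonexpansive (I T : {fun K >-> K})
    (mu lam : nat -> R) (f : R -> R) : Prop :=
  [/\ nonneg_null_sequence mu, nonneg_null_sequence lam, gauge_function f &
      forall x y n, K x -> K y -> (1 <= n)%N ->
        `|iter n T x - iter n T y| <=
          `|iter n I x - iter n I y|
          + mu n * f `|iter n I x - iter n I y| + lam n].

Definition fixed_points (T : {fun K >-> K}) : set X :=
  [set x | K x /\ T x = x].

Definition common_fixed_points (m : nat) (T I : 'I_m -> {fun K >-> K}) :
    set X :=
  \bigcap_(i in [set: 'I_m]) (fixed_points (T i) `&` fixed_points (I i)).

End mappings.

Definition dist_to_set (R : realType) (X : normedModType R) (F : set X)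
    (x : X) : R :=
  inf [set `|x - p| | p in F].

(* Main.v *)
Require Import Defs.
From HB Require Import structures.
From mathcomp Require Import all_boot all_order all_algebra.
From mathcomp Require Import all_classical all_reals all_analysis.
From mathcomp Require Import ring lra.

Set Implicit Arguments.
Unset Strict Implicit.
Unset Printing Implicit Defensive.

Import Order.TTheory GRing.Theory Num.Theory.
Import numFieldNormedType.Exports.

Local Open Scope classical_set_scope.
Local Open Scope ring_scope.

(* For p in F, linear growth of the gauges outside a bounded interval gives
   phi t <= phi M + M* t for all t >= 0, so one step of the iteration satisfies
   |x_{n+1} - p| <= exp(g_n) (|x_n - p| + h_n) with g and h summable and
   independent of p. Hence |x_k - p| <= exp(sum g) (|x_n - p| + sum_{j >= n} h_j)
   for k >= n >= 1. If liminf d(x_n, F) = 0, both terms on the right can be made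
   small by the choice of n and p, so x is Cauchy; its limit is in the closed set
   F. *)

(** * Summable sequences, a discrete Gronwall inequality, liminf and gauge bounds *)

Section summable_sequences.
Context (R : realType).
Implicit Types (u v : nat -> R).

(** Summability is encoded by bounded partial sums starting at index 1, which leaves the value at 0
    free and keeps all estimates within real finite sums. *)
Definition ge0_summable u :=
  (forall n, (1 <= n)%N -> 0 <= u n) /\
  exists B, forall n, \sum_(1 <= k < n) u k <= B.

Lemma ge0_summableD u v :
  ge0_summable u -> ge0_summable v -> ge0_summable (fun n => u n + v n).
Proof.
move=> [u0 [B uB]] [v0 [C vC]]; split=> [n n1|].
  by rewrite addr_ge0 ?u0 ?v0.
by exists (B + C) => n; rewrite big_split lerD.
Qed.

Lemma ge0_summableZ c u :
  0 <= c -> ge0_summable u -> ge0_summable (fun n => c * u n).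
Proof.
move=> c0 [u0 [B uB]]; split=> [n n1|]; first by rewrite mulr_ge0 ?u0.
by exists (c * B) => n; rewrite -mulr_sumr ler_wpM2l.
Qed.

Lemma ge0_summable_sum m (f : 'I_m -> nat -> R) :
  (forall i, ge0_summable (f i)) -> ge0_summable (fun n => \sum_i f i n).
Proof.
move=> fS; split=> [n n1|].
  by apply: sumr_ge0 => i _; apply: (fS i).1.
have [B fB] := choice (fun i => (fS i).2).
exists (\sum_i B i) => n; rewrite exchange_big.
by apply: ler_sum => i _; apply: fB.
Qed.

Lemma ge0_summable_nneseries u : (forall n, (1 <= n)%N -> 0 <= u n) ->
  (\sum_(1 <= n <oo) (u n)%:E < +oo)%E -> ge0_summable u.
Proof.
move=> u0 uoo; split => //; exists (fine (\sum_(1 <= n <oo) (u n)%:E)) => n.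
have u0E k : (1 <= k)%N -> true -> (0 <= (u k)%:E)%E.
  by move=> k1 _; rewrite lee_fin u0.
rewrite -lee_fin fineK.
  by rewrite -sumEFin; apply: (nneseries_lim_ge n u0E).
by rewrite ge0_fin_numE //; apply: nneseries_ge0.
Qed.

Lemma ge0_summable_bound u : ge0_summable u ->
  exists B, forall n m, (1 <= n)%N -> \sum_(n <= k < m) u k <= B.
Proof.
move=> [u0 [B uB]]; exists B => n m n1.
have [nm|mn] := leqP n m; last first.
  (* An empty block needs [0 <= B], which is the bound on the empty partial sum. *)
  by rewrite big_geq ?(ltnW mn) // (le_trans _ (uB 1%N)) // big_geq.
apply: le_trans (uB m); rewrite (big_cat_nat n1 nm) /= lerDr.
by rewrite big_nat_cond sumr_ge0 // => k /andP[/andP[k1 _] _]; apply: u0.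
Qed.

(** Once a partial sum is within [e] of the supremum of all partial sums, any later block adds less
    than [e]. *)
Lemma ge0_summable_tail u e : ge0_summable u -> 0 < e ->
  exists2 N, (1 <= N)%N &
    forall n m, (N <= n)%N -> \sum_(n <= k < m) u k < e.
Proof.
move=> [u0 [B uB]] e0.
have pos_sum a b : (1 <= a)%N -> 0 <= \sum_(a <= k < b) u k.
  move=> a1; rewrite big_nat_cond sumr_ge0 // => k /andP[/andP[ak _] _].
  exact/u0/(leq_trans a1).
pose S := range (fun n => \sum_(1 <= k < n.+1) u k).
have supS : has_sup S.
  split; first by exists (\sum_(1 <= k < 1) u k); exists 0%N.
  by exists B => _ [n _ <-].
have [_ [N _ <-] SN] := sup_adherent e0 supS.
exists N.+1 => // n m Nn.
have [nm|mn] := leqP n m; last by rewrite big_geq // ltnW.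
have n1 : (1 <= n)%N by apply: leq_trans Nn.
have := ub_le_sup supS.2 (ex_intro2 _ _ m I erefl : S (\sum_(1 <= k < m.+1) u k)).
rewrite (big_cat_nat n1 (leq_trans nm (leqnSn m))) /=.
rewrite (big_cat_nat _ Nn) //=.
rewrite (big_nat_recr m n _ nm) /=.
have := pos_sum N.+1 n isT; have := u0 m (leq_trans n1 nm).
lra.
Qed.

(** Induction on [k]: the new perturbation [h (N + k)] enters the bracket because the accumulated
    exponential factor is at least 1. *)
Lemma discrete_gronwall (a g h : nat -> R) N :
  (forall n, (N <= n)%N -> 0 <= g n) -> (forall n, (N <= n)%N -> 0 <= h n) ->
  (forall n, (N <= n)%N -> a n.+1 <= expR (g n) * (a n + h n)) ->
  forall k, a (N + k)%N <=
    expR (\sum_(N <= j < N + k) g j) * (a N + \sum_(N <= j < N + k) h j).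
Proof.
move=> g0 h0 step; elim=> [|k IHk].
  by rewrite addn0 !big_geq // expR0 mul1r addr0.
rewrite addnS !big_nat_recr ?leq_addr //=.
have Nk : (N <= N + k)%N by apply: leq_addr.
apply: (le_trans (step _ Nk)).
rewrite [_ + g _]addrC expRD -mulrA ler_wpM2l ?expR_ge0 //.
rewrite addrA mulrDr lerD // ler_peMl ?h0 // -expR0 ler_expR.
by rewrite big_nat_cond sumr_ge0 // => j /andP[/andP[Nj _] _]; apply: g0.
Qed.

(** The liminf is the supremum of the tail infima, so the infimum of the tail from [N] is at most 0
    and some term of that tail lies below [e]. *)
Lemma limn_einf_eq0_frequently u e N : limn_einf (fun n => (u n)%:E) = 0%E ->
  0 < e -> exists2 n, (N <= n)%N & u n < e.
Proof.
move=> u0 e0.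
have : (einfs (fun n => (u n)%:E) N <= 0)%E.
  rewrite -u0 limn_einf_lim (cvg_lim _ (@cvg_einfs_sup _ _)) //.
  by apply: ereal_sup_ubound; exists N.
move=> /le_lt_trans /(_ (_ : (0 < e%:E)%E)); rewrite lte_fin => /(_ e0).
move=> /ereal_inf_lt [_ [n Nn <-]]; rewrite lte_fin; by exists n.
Qed.

(** Monotonicity handles [t < M] and linear growth handles [M <= t]; in each case the other summand
    is nonnegative. *)
Lemma gauge_affine_bound (f : R -> R) M c t : gauge_function f ->
  0 < M -> (forall s, M <= s -> f s <= c * s) -> 0 <= c -> 0 <= t ->
  f t <= f M + c * t.
Proof.
move=> [fge0 fmono _ _] M0 fM c0 t0.
have [Mt|tM] := leP M t.
  apply: (le_trans (fM _ Mt)); rewrite lerDr.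
  by have := fge0 M; rewrite /= !in_itv /= !andbT; apply; apply: ltW.
rewrite -[f t]addr0 lerD ?mulr_ge0 // ltW //.
by apply: fmono => //; rewrite in_itv /= ?t0 // ltW.
Qed.

End summable_sequences.

(** * Finite convex combinations *)

Section convex_combinations.
Context (R : realType) (X : normedModType R).

(** Induction on [n]: the last point is split off and the others, rescaled by their total weight
    [W > 0], form a shorter convex combination [s]. *)
Lemma convex_set_sum (K : set X) n (w : 'I_n.+1 -> R) (z : 'I_n.+1 -> X) :
  convex_set (K : set (convex_lmodType X)) ->
  (forall j, 0 < w j) -> \sum_j w j = 1 -> (forall j, K (z j)) ->
  K (\sum_j w j *: z j).
Proof.
move=> cK; elim: n w z => [|n IHn] w z w0 w1 Kz.
  by move: w1; rewrite !big_ord1 => ->; rewrite scale1r.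
rewrite big_ord_recr /=; set l := w ord_max.
move: w1; rewrite big_ord_recr /= -/l; set W := \sum_(_ < _) _ => w1.
have W0 : 0 < W.
  apply: (@lt_le_trans _ _ (w (widen_ord (leqnSn n.+1) ord0))) => //.
  by rewrite /W (bigD1 ord0) //= lerDl sumr_ge0 // => i _; rewrite ltW.
have W1 : W <= 1 by rewrite -w1 lerDl ltW // w0.
pose s : X := \sum_(i < n.+1) (w (widen_ord (leqnSn n.+1) i) / W)
            *: z (widen_ord (leqnSn n.+1) i).
have Ks : K s.
  apply: IHn => [j||j] //; first by rewrite divr_gt0.
  by rewrite -mulr_suml divff ?gt_eqF.
have -> : \sum_(i < n.+1) w (widen_ord (leqnSn n.+1) i)
      *: z (widen_ord (leqnSn n.+1) i) = W *: s.
  rewrite scaler_sumr; apply: eq_bigr => i _.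
  by rewrite scalerA mulrCA divff ?mulr1 ?gt_eqF.
have -> : l = 1 - W by rewrite -w1 addrAC subrr add0r.
have := cK s (z ord_max) (Itv01 (ltW W0) W1).
by rewrite !inE; apply.
Qed.

Lemma ler_norm_convex_sum n (w : 'I_n -> R) (z : 'I_n -> X) p U :
  (forall j, 0 <= w j) -> \sum_j w j = 1 -> (forall j, `|z j - p| <= U) ->
  `|\sum_j w j *: z j - p| <= U.
Proof.
move=> w0 w1 zU.
have -> : \sum_j w j *: z j - p = \sum_j w j *: (z j - p).
  under [RHS]eq_bigr do rewrite scalerBr.
  by rewrite sumrB -scaler_suml w1 scale1r.
apply: le_trans (ler_norm_sum _ _ _) _.
rewrite -[U]mul1r -w1 mulr_suml; apply: ler_sum => j _.
by rewrite normrZ ger0_norm // ler_wpM2l.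
Qed.

End convex_combinations.

(* Once the sequence comes close to a point of F it stays close to that same
   point, hence is Cauchy. *)
Lemma quasi_fejer_cvg (R : realType) (X : completeNormedModType R)
    (F : set X) (x : nat -> X) (g h : nat -> R) :
  closed F -> ge0_summable g -> ge0_summable h ->
  (forall p n, F p -> (1 <= n)%N ->
    `|x n.+1 - p| <= expR (g n) * (`|x n - p| + h n)) ->
  (forall e N, 0 < e ->
    exists2 n, (N <= n)%N & exists2 p, F p & `|x n - p| < e) ->
  exists2 p, F p & x @ \oo --> p.
Proof.
move=> cF gS hS step near_F.
have /cauchy_cvg/cvg_ex[q xq] : cauchy (x @ \oo).
  (* It suffices to find, for each [e], one ball of radius [e] containing all late terms; its centre
     will be a point of [F]. *)
  apply: cauchy_exP => e e0.
  have [B gB] := ge0_summable_bound gS.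
  (* With [B] bounding every block sum of [g], this choice gives [expR B * (d + d) = e]: one [d] for
     the distance to [p], one for the tail of [h]. *)
  pose d := e / (2 * expR B).
  have d0 : 0 < d by rewrite divr_gt0 // mulr_gt0 // expR_gt0.
  have [N N1 hN] := ge0_summable_tail hS d0.
  have [n Nn [p Fp xnp]] := near_F d N d0.
  have n1 : (1 <= n)%N by apply: leq_trans Nn.
  exists p; exists n => // k /= nk.
  rewrite -ball_normE /= distrC -(subnKC nk).
  apply: le_lt_trans (@discrete_gronwall _ (fun k => `|x k - p|) g h n _ _ _ _) _.
  - by move=> j nj; apply: gS.1; apply: leq_trans nj.
  - by move=> j nj; apply: hS.1; apply: leq_trans nj.
  - by move=> j nj; apply: step => //; apply: leq_trans nj.
  have -> : e = expR B * (d + d).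
    have EB : expR B != 0 by rewrite gt_eqF // expR_gt0.
    by rewrite /d; field.
  apply: le_lt_trans (_ : _ <= expR B * _) _.
    apply: ler_wpM2r; last by rewrite ler_expR gB.
    rewrite addr_ge0 //.
    rewrite big_nat_cond sumr_ge0 // => j /andP[/andP[nj _] _].
    by apply: hS.1; apply: leq_trans nj.
  by rewrite ltr_pM2l ?expR_gt0 // ltrD // hN.
(* The limit is adherent to [F]: some late [x n] is within [e / 2] both of [q] and of a point of
   [F]. *)
exists q => //; apply: cF => B /nbhs_ballP[e /= e0 qB].
have e20 : 0 < e / 2 by rewrite divr_gt0.
have /cvgrPdist_lt /(_ _ e20) [N _ xN] := xq.
have [n Nn [p Fp xnp]] := near_F _ N e20.
exists p; split => //; apply: qB; rewrite -ball_normE /=.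
by rewrite [e]splitr (le_lt_trans (ler_distD (x n) q p)) // ltrD // xN.
Qed.

(** * Closedness of fixed point sets and invariance of [K] *)

Section fixed_point_sets.
Context (R : realType) (X : normedModType R) (K : set X).

(** Continuity holds only within [K], so the zero set of [T - id] is first closed in the subspace
    [K]; closedness of [K] transfers this to [X]. *)
Lemma closed_fixed_points (T : {fun K >-> K}) : closed K ->
  {within K, continuous T} -> closed (fixed_points T).
Proof.
move=> cK Tc.
have Tidc : {within K, continuous ((T : X -> X) - id)}.
  apply: within_continuousB; first exact: Tc.
  by apply: continuous_subspaceT => x; apply: cvg_id.
have -> : fixed_points T = K `&` ((T : X -> X) - id) @^-1` [set 0].
  rewrite eqEsubset; split=> [x [Kx Tx]|x [Kx TxE]]; split => //.
    by apply/eqP; rewrite subr_eq0; apply/eqP.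
  by apply/eqP; rewrite -subr_eq0; apply/eqP.
have c0 : closed [set (0 : X)].
  exact/accessible_closed_set1/hausdorff_accessible/norm_hausdorff.
rewrite -[_ @^-1` _]/((((T : X -> X) - id) : subspace K -> X) @^-1` [set 0]).
have /continuous_closedP /(_ _ c0) := Tidc.
by rewrite -closed_setSI // => /(closed_setIS _ cK).
Qed.

Lemma closed_common_fixed_points m (T I : 'I_m -> {fun K >-> K}) : closed K ->
  (forall i, {within K, continuous (T i)}) ->
  (forall i, {within K, continuous (I i)}) ->
  closed (common_fixed_points T I).
Proof.
move=> cK Tc Ic; apply: closed_bigI => i _.
by apply: closedI; apply: closed_fixed_points.
Qed.

Lemma iter_fun (T : {fun K >-> K}) n x : K x -> K (iter n T x).
Proof. by move=> Kx; elim: n => //= n IHn; apply: funS. Qed.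

End fixed_point_sets.

(** * Scalar estimates for one step of the iteration *)

Lemma ler_sum_term (R : numDomainType) m (f : 'I_m -> R) i :
  (forall j, 0 <= f j) -> f i <= \sum_j f j.
Proof. by move=> f0; rewrite (bigD1 i) //= lerDl sumr_ge0. Qed.

(** Serves both the [I i] and the [T i]; [A] and [B] are only upper bounds, so that constants common
    to all indices can be used. *)
Lemma gauge_step_bound (R : realType) (f : R -> R) M c u l A B t :
  gauge_function f -> 0 < M -> (forall s, M <= s -> f s <= c * s) -> 0 <= c ->
  0 <= u -> u * c <= A -> u * f M + l <= B -> 0 <= t ->
  t + u * f t + l <= (1 + A) * t + B.
Proof.
move=> gf M0 fM c0 u0 uA uB t0.
have uf := ler_wpM2l u0 (gauge_affine_bound gf M0 fM c0 t0).
have uct := ler_wpM2r t0 uA.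
by move: uf; rewrite mulrDr mulrA mulrDl mul1r; lra.
Qed.

(** The left side equals [P * t + (1 + C) * (2 + A) * B + D] with [P = (1 + C) * (1 + A) ^ 2]. The
    coefficient of [B] is at most [2 * P], that of [D] at most [P], and [1 + s <= expR s] bounds
    [P]. *)
Lemma two_step_expR_bound (R : realType) (A B C D t : R) :
  0 <= A -> 0 <= B -> 0 <= C -> 0 <= D -> 0 <= t ->
  (1 + C) * ((1 + A) * ((1 + A) * t + B) + B) + D <=
  expR (C + 2 * A) * (t + (2 * B + D)).
Proof.
move=> A0 B0 C0 D0 t0.
pose P := (1 + C) * ((1 + A) * (1 + A)).
have PE : P <= expR (C + 2 * A).
  rewrite expRD (_ : 2 * A = A + A) ?expRD; last by ring.
  rewrite /P; do ?apply: ler_pM; do ?[exact: expR_ge1Dx]; rewrite ?mulr_ge0 //; lra.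
apply: (@le_trans _ _ (P * (t + (2 * B + D)))); last first.
  by apply: ler_wpM2r => //; lra.
have CA := mulr_ge0 C0 A0; have AA := mulr_ge0 A0 A0.
have CAA := mulr_ge0 C0 AA.
have P1 : 0 <= (P - 1) * D by rewrite mulr_ge0 // /P; lra.
have P2 : 0 <= (2 * P - (1 + C) * (2 + A)) * B by rewrite mulr_ge0 // /P; lra.
rewrite -subr_ge0; move: (addr_ge0 P1 P2); congr (0 <= _); rewrite /P; ring.
Qed.

Theorem theorem3p5 (R : realType) (X : completeNormedModType R)
  (uniformly_convex_X : uniformly_convex X)
  (K : set X) (K_nonempty : K !=set0) (K_closed : closed K)
  (K_convex : convex_set (K : set (convex_lmodType X)))
  (m : nat) (m_ge1 : (1 <= m)%N)
  (I T : 'I_m -> {fun K >-> K})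
  (mut lamt : 'I_m -> nat -> R) (varphi : 'I_m -> R -> R)
  (mu lam : 'I_m -> nat -> R) (phi : 'I_m -> R -> R)
  (I_continuous : forall i, {within K, continuous (I i)})
  (I_tan : forall i,
    total_asymptotically_nonexpansive (I i) (mut i) (lamt i) (varphi i))
  (T_continuous : forall i, {within K, continuous (T i)})
  (T_tan : forall i,
    total_asymptotically_I_nonexpansive (I i) (T i) (mu i) (lam i) (phi i))
  (F_nonempty : common_fixed_points T I !=set0)
  (mu_summable : forall i, (\sum_(1 <= n <oo) (mu i n)%:E < +oo)%E)
  (lam_summable : forall i, (\sum_(1 <= n <oo) (lam i n)%:E < +oo)%E)
  (mut_summable : forall i, (\sum_(1 <= n <oo) (mut i n)%:E < +oo)%E)
  (lamt_summable : forall i, (\sum_(1 <= n <oo) (lamt i n)%:E < +oo)%E)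
  (linear_growth : exists M Ms N Ns : 'I_m -> R, forall i,
    [/\ [/\ 0 < M i, 0 < Ms i, 0 < N i & 0 < Ns i],
        forall xi, M i <= xi -> phi i xi <= Ms i * xi &
        forall zeta, N i <= zeta -> varphi i zeta <= Ns i * zeta])
  (alpha beta : 'I_m.+1 -> nat -> R)
  (alpha01 : forall j n, (1 <= n)%N -> 0 < alpha j n < 1)
  (beta01 : forall j n, (1 <= n)%N -> 0 < beta j n < 1)
  (alpha_sum : forall n, (1 <= n)%N -> \sum_(j < m.+1) alpha j n = 1)
  (beta_sum : forall n, (1 <= n)%N -> \sum_(j < m.+1) beta j n = 1)
  (x y : nat -> X) (x1K : K (x 1%N))
  (yE : forall n, (1 <= n)%N ->
    y n = beta ord0 n *: x n
          + \sum_(i < m) beta (lift ord0 i) n *: iter n (I i) (x n))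
  (xE : forall n, (1 <= n)%N ->
    x n.+1 = alpha ord0 n *: x n
             + \sum_(i < m) alpha (lift ord0 i) n *: iter n (T i) (y n)) :
  (exists2 p : X, common_fixed_points T I p & x @ \oo --> p) <->
  limn_einf (fun n => (dist_to_set (common_fixed_points T I) (x n))%:E) = 0%E.
Proof.
set F := common_fixed_points T I.
have cF : closed F by exact: closed_common_fixed_points.
have dist_ge0 z : 0 <= dist_to_set F z.
  apply: lb_le_inf => [|_ [p _ <-] //].
  by case: F_nonempty => p Fp; exists `|z - p|; exists p.
have dist_le z p : F p -> dist_to_set F z <= `|z - p|.
  move=> Fp; apply: ge_inf; last by exists p.
  by exists 0 => _ [q _ <-].
split=> [[p Fp xp]|liminf0].
  (* Necessity: the distance to [F] is squeezed between 0 and [|x n - p|], so it converges to 0, and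
     its liminf is this limit. *)
  apply: (fst (@cvg_limn_einf_sup _ _ 0%E _)).
  apply: cvg_EFin; first exact: nearW.
  apply: (@squeeze_cvgr _ _ _ _ (fun=> 0) (fun n => `|x n - p|)).
  - by apply: nearW => n; rewrite dist_ge0 dist_le.
  - exact: cvg_cst.
  - rewrite -(normr0 X) -(subrr p); apply: cvg_norm.
    by apply: cvgB => //; exact: cvg_cst.
have [M [Ms [N [Ns growth]]]] := linear_growth.
(* Summing over [i] gives coefficients valid for all maps at once: [A], [C] are the relative errors
   of the [I i] and [T i], and [B], [D] the additive ones. *)
pose A n := \sum_i Ns i * mut i n.
pose B n := \sum_i (varphi i (N i) * mut i n + lamt i n).
pose C n := \sum_i Ms i * mu i n.
pose D n := \sum_i (phi i (M i) * mu i n + lam i n).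
have gauge_ge0 f t : gauge_function f -> 0 < t -> 0 <= f t :> R.
  move=> [f0 _ _ _] t0; have := f0 t; rewrite /= !in_itv /= !andbT.
  by apply; apply: ltW.
have varphi0 i : 0 <= varphi i (N i).
  by have [_ _ gf _] := I_tan i; have [[]] := growth i => *; apply: gauge_ge0.
have phi0 i : 0 <= phi i (M i).
  by have [_ _ gf _] := T_tan i; have [[]] := growth i => *; apply: gauge_ge0.
have Ns0 i : 0 <= Ns i by have [[_ _ _ /ltW]] := growth i.
have Ms0 i : 0 <= Ms i by have [[_ /ltW]] := growth i.
have mutS i : ge0_summable (mut i).
  by have [[u0 _] _ _ _] := I_tan i; apply: ge0_summable_nneseries.
have lamtS i : ge0_summable (lamt i).
  by have [_ [u0 _] _ _] := I_tan i; apply: ge0_summable_nneseries.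
have muS i : ge0_summable (mu i).
  by have [[u0 _] _ _ _] := T_tan i; apply: ge0_summable_nneseries.
have lamS i : ge0_summable (lam i).
  by have [_ [u0 _] _ _] := T_tan i; apply: ge0_summable_nneseries.
have Ai i : ge0_summable (fun n => Ns i * mut i n) by exact: ge0_summableZ.
have Bi i : ge0_summable (fun n => varphi i (N i) * mut i n + lamt i n).
  by apply: ge0_summableD => //; apply: ge0_summableZ.
have Ci i : ge0_summable (fun n => Ms i * mu i n) by exact: ge0_summableZ.
have Di i : ge0_summable (fun n => phi i (M i) * mu i n + lam i n).
  by apply: ge0_summableD => //; apply: ge0_summableZ.
have AS : ge0_summable A by exact: ge0_summable_sum.
have BS : ge0_summable B by exact: ge0_summable_sum.
have CS : ge0_summable C by exact: ge0_summable_sum.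
have DS : ge0_summable D by exact: ge0_summable_sum.
have F_fix p i : F p -> [/\ K p, T i p = p & I i p = p].
  by move=> /(_ i Logic.I) [[Kp Tp] [_ Ip]].
have I_bound p z n i : F p -> K z -> (1 <= n)%N ->
    `|iter n (I i) z - p| <= (1 + A n) * `|z - p| + B n.
  move=> Fp Kz n1; have [Kp _ Ip] := F_fix p i Fp.
  have [_ _ gf I_le] := I_tan i; have [[_ _ N0 _] _ fN] := growth i.
  have := I_le z p n Kz Kp n1; rewrite (iter_fix n Ip) => /le_trans; apply.
  apply: (@gauge_step_bound _ _ (N i) (Ns i)) => //; first exact: (mutS i).1.
  - rewrite mulrC; apply: (ler_sum_term (f := fun i => Ns i * mut i n)) => j.
    exact: (Ai j).1.
  - rewrite [mut i n * _]mulrC.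
    apply: (ler_sum_term (f := fun i => varphi i (N i) * mut i n + lamt i n)).
    by move=> j; apply: (Bi j).1.
have T_bound p z n i : F p -> K z -> (1 <= n)%N ->
    `|iter n (T i) z - p| <=
      (1 + C n) * ((1 + A n) * `|z - p| + B n) + D n.
  move=> Fp Kz n1; have [Kp Tp Ip] := F_fix p i Fp.
  have [_ _ gf T_le] := T_tan i; have [[M0 _ _ _] fM _] := growth i.
  have := T_le z p n Kz Kp n1; rewrite (iter_fix n Ip) (iter_fix n Tp).
  move=> /le_trans; apply.
  (* The gauge of [T i] is evaluated at the distance from the [I i] iterate to [p], which [I_bound]
     then controls. *)
  apply: le_trans (_ : _ <= (1 + C n) * `|iter n (I i) z - p| + D n) _.
    apply: (@gauge_step_bound _ _ (M i) (Ms i)) => //; first exact: (muS i).1.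
    - rewrite mulrC; apply: (ler_sum_term (f := fun i => Ms i * mu i n)) => j.
      exact: (Ci j).1.
    - rewrite [mu i n * _]mulrC.
      apply: (ler_sum_term (f := fun i => phi i (M i) * mu i n + lam i n)).
      by move=> j; apply: (Di j).1.
  by rewrite lerD2r ler_wpM2l ?I_bound // addr_ge0 // CS.1.
(* Placing [z0] at index 0 in front of the [z i] turns [y n] and [x n.+1] into single convex
   combinations over [m.+1] indices. *)
pose family z0 (z : 'I_m -> X) j := oapp z z0 (unlift ord0 j).
have family0 z0 z : family z0 z ord0 = z0 by rewrite /family unlift_none.
have familyS z0 z i : family z0 z (lift ord0 i) = z i by rewrite /family liftK.
have yE' n : (1 <= n)%N -> y n =
    \sum_j beta j n *: family (x n) (fun i => iter n (I i) (x n)) j.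
  move=> n1; rewrite yE // big_ord_recl family0; congr (_ + _).
  by apply: eq_bigr => i _; rewrite familyS.
have xE' n : (1 <= n)%N -> x n.+1 =
    \sum_j alpha j n *: family (x n) (fun i => iter n (T i) (y n)) j.
  move=> n1; rewrite xE // big_ord_recl family0; congr (_ + _).
  by apply: eq_bigr => i _; rewrite familyS.
have family_all (P : X -> Prop) z0 z : P z0 -> (forall i, P (z i)) ->
    forall j, P (family z0 z j).
  by move=> Pz0 Pz j; rewrite /family; case: unlift => /=.
have Ky n : (1 <= n)%N -> K (x n) -> K (y n).
  move=> n1 Kx; rewrite yE' //; apply: convex_set_sum => //.
  - by move=> j; case/andP: (beta01 j n n1).
  - exact: beta_sum.
  - by apply: family_all => // i; apply: iter_fun.
have Kx n : (1 <= n)%N -> K (x n).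
  case: n => // n _; elim: n => // n IHn.
  rewrite xE' //; apply: convex_set_sum => //.
  - by move=> j; case/andP: (alpha01 j n.+1 isT).
  - exact: alpha_sum.
  - by apply: family_all => // i; apply: iter_fun; apply: Ky.
have step p n : F p -> (1 <= n)%N -> `|x n.+1 - p| <=
    expR (C n + 2 * A n) * (`|x n - p| + (2 * B n + D n)).
  move=> Fp n1.
  have [A0 B0 C0 D0] := And4 (AS.1 n n1) (BS.1 n n1) (CS.1 n n1) (DS.1 n n1).
  (* Makes the term [x n] of each combination satisfy the same bound as the iterates. *)
  have ge_first a b (t : R) : 0 <= a -> 0 <= b -> 0 <= t -> t <= (1 + a) * t + b.
    by move=> a0 b0 t0; rewrite mulrDl mul1r -addrA lerDl addr_ge0 // mulr_ge0.
  have y_bound : `|y n - p| <= (1 + A n) * `|x n - p| + B n.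
    rewrite yE' //; apply: ler_norm_convex_sum; last 1 first.
    - apply: (family_all (fun z => `|z - p| <= _)); first exact: ge_first.
      by move=> i; apply: I_bound => //; apply: Kx.
    - by move=> j; case/andP: (beta01 j n n1) => /ltW.
    - exact: beta_sum.
  apply: le_trans (two_step_expR_bound A0 B0 C0 D0 (normr_ge0 _)).
  rewrite xE' //; apply: ler_norm_convex_sum; last 1 first.
  - apply: (family_all (fun z => `|z - p| <= _)).
      have t1 := ge_first _ _ _ A0 B0 (normr_ge0 (x n - p)).
      have t2 := ge_first _ _ _ A0 B0 (le_trans (normr_ge0 _) t1).
      have t3 := ge_first _ _ _ C0 D0 (le_trans (normr_ge0 _) (le_trans t1 t2)).
      exact: le_trans t1 (le_trans t2 t3).
    move=> i; apply: (le_trans (T_bound p _ n i Fp (Ky n n1 (Kx n n1)) n1)).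
    rewrite lerD2r ler_wpM2l ?addr_ge0 // lerD2r ler_wpM2l ?addr_ge0 //.
  - by move=> j; case/andP: (alpha01 j n n1) => /ltW.
  - exact: alpha_sum.
apply: (quasi_fejer_cvg cF _ _ step).
- by apply: ge0_summableD => //; apply: ge0_summableZ.
- by apply: ge0_summableD => //; apply: ge0_summableZ.
move=> e k e0; have [n kn xn] := limn_einf_eq0_frequently k liminf0 e0.
exists n => //.
have dist_inf : has_inf [set `|x n - p| | p in F].
  split; last by exists 0 => _ [q _ <-].
  by case: F_nonempty => p Fp; exists `|x n - p|; exists p.
(* The slack left below [e] lets the infimum be replaced by the distance to an actual point of
   [F]. *)
have e'0 : 0 < e - dist_to_set F (x n) by rewrite subr_gt0.
have [_ [p Fp <-]] := inf_adherent e'0 dist_inf.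
by rewrite [ltRHS]addrC subrK; exists p.
Qed.
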